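(* Let $k$ be an algebraically closed field of characteristic $p>0$, let $q=p^e$ with $e\ge1$, and let $X\subset\mathbb P^{n-1}_k$ be a smooth extremal hypersurface of degree $q+1$ and dimension $n-2\ge 0$. The group $\operatorname{Aut}(X)$ of projective linear automorphisms of $X$ is isomorphic to the finite group $\operatorname{PU}(n,\mathbb F_{q^2})$, where $\operatorname{PU}(n,\mathbb F_{q^2})$ is the quotient of the finite unitary group $$\operatorname{U}(n,\mathbb F_{q^2})=\left\{g\in \operatorname{GL}(n,\mathbb F_{q^2})\ \big|\ (g^{[q]})^\top g=I_n\right\}$$ by its center $\{\lambda I_n\mid \lambda^{q+1}=1\}$, the cyclic group of scalar matrices of order $q+1$.
   Context: $k$ is an algebraically closed field of characteristic $p>0$ and $q=p^e$ with $e\ge1$. A Frobenius form in variables $x_1,\dots,x_n$ is a homogeneous polynomial of degree $q+1$ of the form $\sum_{i=1}^n x_i^{q}L_i$ with each $L_i$ a linear form. An extremal hypersurface of degree $q+1$ is a hypersurface in $\mathbb P^{n-1}_k$ defined by a Frobenius form of degree $q+1$ in $n$ variables. $\operatorname{Aut}(X)$ is the subgroup of $\operatorname{PGL}(n,k)$ preserving $X$. For a matrix $B$, $B^{[q]}$ denotes the matrix obtained by raising each entry of $B$ to the $q$-th power, and $B^\top$ the transpose. *)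

(* Defs.v *)
From HB Require Import structures.
From mathcomp Require Import all_boot all_order all_algebra all_fingroup.
From mathcomp Require Import all_solvable all_field.
From mathcomp Require Import generic_quotient boolp mpoly.

Set Implicit Arguments.
Unset Strict Implicit.
Unset Printing Implicit Defensive.

Import GRing.Theory.
Local Open Scope ring_scope.
Local Open Scope quotient_scope.

Section GL.
Variables (k : fieldType) (n : nat).

Record gl := GLmx { gl_mx :> 'M[k]_n; gl_unit : gl_mx \in unitmx }.
HB.instance Definition _ := [isSub for gl_mx].
HB.instance Definition _ := [Choice of gl by <:].

Definition gl_one := GLmx (unitmx1 k n).

Fact gl_mul_subproof (A B : gl) : (A : 'M_n) *m B \in unitmx.
Proof. by rewrite unitmx_mul !gl_unit. Qed.
Definition gl_mul (A B : gl) := GLmx (gl_mul_subproof A B).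

Fact gl_inv_subproof (A : gl) : invmx A \in unitmx.
Proof. by rewrite unitmx_inv gl_unit. Qed.
Definition gl_inv (A : gl) := GLmx (gl_inv_subproof A).

Fact gl_mulA : associative gl_mul.
Proof. by move=> A B C; apply/val_inj; rewrite /= mulmxA. Qed.
Fact gl_mul1 : left_id gl_one gl_mul.
Proof. by move=> A; apply/val_inj; rewrite /= mul1mx. Qed.
Fact gl_mulr1 : right_id gl_one gl_mul.
Proof. by move=> A; apply/val_inj; rewrite /= mulmx1. Qed.
Fact gl_mulV : left_inverse gl_one gl_inv gl_mul.
Proof. by move=> A; apply/val_inj; rewrite /= mulVmx ?gl_unit. Qed.
Fact gl_mulrV : right_inverse gl_one gl_inv gl_mul.
Proof. by move=> A; apply/val_inj; rewrite /= mulmxV ?gl_unit. Qed.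

HB.instance Definition _ :=
  isGroup.Build gl gl_mulA gl_mul1 gl_mulr1 gl_mulV gl_mulrV.

End GL.

Section ProportionalMatrices.
Variables (k : fieldType) (n m : nat).

Definition proportional (A B : 'M[k]_(n, m)) : Prop :=
  exists2 c : k, c != 0 & A = c *: B.

Lemma proportional_refl A : proportional A A.
Proof. by exists 1; rewrite ?oner_eq0 ?scale1r. Qed.

Lemma proportional_sym A B : proportional A B -> proportional B A.
Proof.
by case=> c c0 ->; exists c^-1; rewrite ?invr_eq0 // scalerA mulVf ?scale1r.
Qed.

Lemma proportional_trans A B C :
  proportional A B -> proportional B C -> proportional A C.
Proof.
case=> c c0 -> [d d0 ->].
by exists (c * d); rewrite ?mulf_neq0 // scalerA.
Qed.

End ProportionalMatrices.

Section PGL.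
Variables (k : fieldType) (n : nat).
Local Notation gl := (gl k n).
Implicit Types A B : gl.

Definition pgl_rel : rel gl := fun A B => `[< proportional A B >].

Fact pgl_rel_refl : reflexive pgl_rel.
Proof. by move=> A; apply/asboolP/proportional_refl. Qed.
Fact pgl_rel_sym : ssrbool.symmetric pgl_rel.
Proof. by move=> A B; apply/asboolP/asboolP; apply: proportional_sym. Qed.
Fact pgl_rel_trans : transitive pgl_rel.
Proof.
by move=> B A C /asboolP AB /asboolP BC; apply/asboolP/(proportional_trans AB).
Qed.

Canonical pgl_equiv :=
  EquivRel pgl_rel pgl_rel_refl pgl_rel_sym pgl_rel_trans.

Definition pgl := {eq_quot pgl_equiv}.
HB.instance Definition _ : EqQuotient gl pgl_equiv pgl :=
  EqQuotient.on pgl.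
HB.instance Definition _ := Choice.on pgl.

Lemma pglP A B : reflect (proportional A B) (\pi_pgl A == \pi_pgl B).
Proof.
by apply: (iffP idP) => [/eqP/eqmodP/asboolP|h]; last exact/eqP/eqmodP/asboolP.
Qed.

Definition pgl_one : pgl := \pi_pgl (1%g : gl).
Definition pgl_mul (g h : pgl) : pgl := \pi_pgl (repr g * repr h)%g.
Definition pgl_inv (g : pgl) : pgl := \pi_pgl ((repr g)^-1)%g.

Lemma repr_pgl A : proportional (repr (\pi_pgl A)) A.
Proof. by apply/pglP; rewrite reprK. Qed.

Lemma pi_pglM A B : pgl_mul (\pi A) (\pi B) = \pi_pgl (A * B)%g.
Proof.
apply/eqP/pglP; case: (repr_pgl A) (repr_pgl B) => c c0 eA [d d0 eB].
exists (c * d); first exact: mulf_neq0.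
by rewrite /= eA eB -scalemxAl -scalemxAr scalerA.
Qed.

Lemma pi_pglV A : pgl_inv (\pi A) = \pi_pgl (A^-1)%g.
Proof.
apply/eqP/pglP; case: (repr_pgl A) => c c0 eA; exists c^-1.
  by rewrite invr_eq0.
by rewrite /= eA invmxZ // unitmxZ ?unitfE ?gl_unit.
Qed.

Fact pgl_mulA : associative pgl_mul.
Proof.
by elim/quotW=> A; elim/quotW=> B; elim/quotW=> C; rewrite !pi_pglM mulgA.
Qed.
Fact pgl_mul1 : left_id pgl_one pgl_mul.
Proof. by elim/quotW=> A; rewrite pi_pglM mul1g. Qed.
Fact pgl_mulr1 : right_id pgl_one pgl_mul.
Proof. by elim/quotW=> A; rewrite pi_pglM mulg1. Qed.
Fact pgl_mulV : left_inverse pgl_one pgl_inv pgl_mul.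
Proof. by elim/quotW=> A; rewrite pi_pglV pi_pglM mulVg. Qed.
Fact pgl_mulrV : right_inverse pgl_one pgl_inv pgl_mul.
Proof. by elim/quotW=> A; rewrite pi_pglV pi_pglM mulgV. Qed.

HB.instance Definition _ :=
  isGroup.Build pgl pgl_mulA pgl_mul1 pgl_mulr1 pgl_mulV pgl_mulrV.

End PGL.

Section ProjectiveSpace.
Variables (k : fieldType) (n : nat).

Record nzvec := NzVec { nz_vec :> 'cV[k]_n; nz_vec_neq0 : nz_vec != 0 }.
HB.instance Definition _ := [isSub for nz_vec].
HB.instance Definition _ := [Choice of nzvec by <:].
Implicit Types (u v : nzvec) (A : gl k n).

Definition proj_rel : rel nzvec := fun u v => `[< proportional u v >].

Fact proj_rel_refl : reflexive proj_rel.
Proof. by move=> u; apply/asboolP/proportional_refl. Qed.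
Fact proj_rel_sym : ssrbool.symmetric proj_rel.
Proof. by move=> u v; apply/asboolP/asboolP; apply: proportional_sym. Qed.
Fact proj_rel_trans : transitive proj_rel.
Proof.
by move=> v u w /asboolP uv /asboolP vw; apply/asboolP/(proportional_trans uv).
Qed.

Canonical proj_equiv :=
  EquivRel proj_rel proj_rel_refl proj_rel_sym proj_rel_trans.

(* The closed points of the projective space of dimension n - 1. *)
Definition proj := {eq_quot proj_equiv}.
HB.instance Definition _ : EqQuotient nzvec proj_equiv proj :=
  EqQuotient.on proj.
HB.instance Definition _ := Choice.on proj.

Lemma projP u v : reflect (proportional u v) (\pi_proj u == \pi_proj v).
Proof.
by apply: (iffP idP) => [/eqP/eqmodP/asboolP|h]; last exact/eqP/eqmodP/asboolP.
Qed.

Lemma repr_proj u : proportional (repr (\pi_proj u)) u.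
Proof. by apply/projP; rewrite reprK. Qed.

Fact gl_act_subproof A v : (A : 'M_n) *m v != 0.
Proof.
apply: contra (nz_vec_neq0 v) => /eqP Av0.
by rewrite -[nz_vec v]mul1mx -(mulVmx (gl_unit A)) -mulmxA Av0 mulmx0.
Qed.
Definition gl_act A v := NzVec (gl_act_subproof A v).

Definition pgl_act (g : pgl k n) (x : proj) : proj :=
  \pi_proj (gl_act (repr g) (repr x)).

Lemma pi_pgl_act A v :
  pgl_act (\pi_(pgl k n) A) (\pi_proj v) = \pi_proj (gl_act A v).
Proof.
apply/eqP/projP; case: (repr_pgl A) (repr_proj v) => c c0 eA [d d0 ev].
exists (c * d); first exact: mulf_neq0.
by rewrite /= eA ev -scalemxAl -scalemxAr scalerA.
Qed.

Lemma pgl_act1 x : pgl_act 1%g x = x.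
Proof.
elim/quotW: x => v; rewrite pi_pgl_act; congr (\pi_proj _).
by apply/val_inj; rewrite /= mul1mx.
Qed.

Lemma pgl_actM g h x : pgl_act (g * h)%g x = pgl_act g (pgl_act h x).
Proof.
elim/quotW: g => A; elim/quotW: h => B; elim/quotW: x => v.
rewrite [(\pi_(pgl k n) A * _)%g]pi_pglM (pi_pgl_act B) !pi_pgl_act.
congr (\pi_proj _).
by apply/val_inj; rewrite /= mulmxA.
Qed.

End ProjectiveSpace.

Section Aut.
Variables (k : fieldType) (n : nat) (X : proj k n -> Prop).

(* The image of X under g is X, written pointwise for the bijection g. *)
Definition preserves (g : pgl k n) : Prop :=
  forall x, X (pgl_act g x) <-> X x.

Definition aut_pred : pred (pgl k n) := fun g => `[< preserves g >].

Fact aut_group_closed : group_closed aut_pred.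
Proof.
split=> [|g h]; rewrite -!topredE /=.
  by apply/asboolP=> x; rewrite pgl_act1.
move=> /asboolP gX /asboolP hX; apply/asboolP=> x.
by rewrite pgl_actM gX -(hX (pgl_act h^-1 x)%g) -pgl_actM mulgV pgl_act1.
Qed.

Record proj_aut :=
  ProjAut { proj_aut_val :> pgl k n; _ : aut_pred proj_aut_val }.
HB.instance Definition _ := [isSub for proj_aut_val].
HB.instance Definition _ := [Choice of proj_aut by <:].
HB.instance Definition _ :=
  SubChoice_isSubGroup.Build (pgl k n) aut_pred proj_aut aut_group_closed.

End Aut.

Section Hypersurface.
Variables (k : fieldType) (n : nat).
Implicit Type F : {mpoly k[n]}.

Definition eval_at F (v : 'cV[k]_n) : k := F.@[fun i => v i 0].

Definition zero_locus F (x : proj k n) : Prop :=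
  forall v : nzvec k n, x = \pi_(proj k n) v -> eval_at F v = 0.

Lemma eval_atZ d F c v :
  F \is d.-homog -> eval_at F (c *: v) = c ^+ d * eval_at F v.
Proof.
move=> /dhomogP homF; rewrite /eval_at !mevalE big_distrr /= !big_seq.
apply: eq_bigr => m mF; rewrite mulrCA; congr *%R.
have -> : d = (\sum_(i < n) m i)%N by rewrite -mdegE; apply/esym/homF.
rewrite -prodrXr -big_split /=.
by apply: eq_bigr => i _; rewrite !mxE exprMn.
Qed.

Lemma zero_locus_pi d F (v : nzvec k n) :
  F \is d.-homog -> zero_locus F (\pi_(proj k n) v) <-> eval_at F v = 0.
Proof.
move=> homF; split=> [|Fv0 u /esym/eqP/projP[c _ ->]]; first exact.
by rewrite (eval_atZ _ _ homF) Fv0 mulr0.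
Qed.

Definition frobenius_form (q : nat) F : Prop :=
  exists2 L : 'I_n -> {mpoly k[n]},
    forall i, L i \is 1.-homog & F = \sum_(i < n) 'X_i ^+ q * L i.

(* Jacobian criterion on homogeneous coordinates of the closed points. For
   n >= 2 a nonconstant form F satisfying it is reduced, so F = 0 is
   determined by its zero locus over an algebraically closed field. *)
Definition smooth_hypersurface F : Prop :=
  forall v : nzvec k n, eval_at F v = 0 ->
    exists i : 'I_n, eval_at F^`M(i) v != 0.

End Hypersurface.

Section Unitary.
Variables (n p e : nat) (L : finFieldType).
Local Notation q := (p ^ e)%N.

Definition frob_mx m (A : 'M[L]_m) : 'M[L]_m := map_mx (fun x => x ^+ q) A.

Definition unitary : {set {'GL_n[L]}} :=
  [set g | (frob_mx (GLval g))^T *m GLval g == 1%:M].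

Hypothesis charL : p \in [pchar L].

Fact q_gt0 : (0 < q)%N.
Proof. by rewrite expn_gt0 prime_gt0 ?(pcharf_prime charL). Qed.

Lemma frob_mxM m (A B : 'M[L]_m) :
  frob_mx (A *m B) = frob_mx A *m frob_mx B.
Proof.
have q_nat : [pchar L].-nat q.
  by rewrite pnatX (eq_pnat _ (pcharf_eq charL)) pnat_id ?(pcharf_prime charL).
have qD : {morph (fun x : L => x ^+ q) : x y / x + y}.
  by move=> x y; exact: exprDn_pchar.
have q0 : (0 : L) ^+ q = 0 by rewrite expr0n eqn0Ngt q_gt0.
apply/matrixP=> i j; rewrite !mxE (big_morph _ qD q0).
by apply: eq_bigr => l _; rewrite !mxE exprMn.
Qed.

Fact unitary_group_set : group_set unitary.
Proof.
apply/group_setP; split=> [|g h]; rewrite !inE.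
  apply/eqP/matrixP=> i j; rewrite mulmx1 !mxE eq_sym.
  by case: eqP => _; rewrite ?expr1n // expr0n eqn0Ngt q_gt0.
move=> /eqP ug /eqP uh; rewrite GL_ME /= -[_ * _]/(_ *m _) frob_mxM trmx_mul.
by rewrite -mulmxA (mulmxA _ (GLval g)) ug mul1mx uh.
Qed.
Definition unitary_group := Group unitary_group_set.

Definition PU : finGroupType :=
  [subg (unitary_group / 'Z(unitary_group))%G].

End Unitary.

Definition group_isomorphic (G H : groupType) : Prop :=
  exists f : {multiplicative G -> H}, bijective f.

(* Main.v *)
(* A Frobenius form is F(v) = (v^[q])^T A v, and smoothness forces A to be
   invertible. The map v |-> A^-1 (A^[q])^T v^[q^2] is bijective and
   q^2-semilinear, so by Lang's theorem its fixed vectors span; on them the form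
   is Hermitian over F_{q^2}, and Gram-Schmidt gives B with
   (B^[q])^T A B = 1, i.e. X becomes the Fermat hypersurface. A linear map h
   preserving the Fermat hypersurface satisfies (h^[q])^T h = c by comparing
   forms on the lines through pairs of coordinate points. After rescaling,
   c = 1; then h^[q^2] = h, so h is a unitary matrix over F_{q^2}. *)
From HB Require Import structures.
Require Import Defs.
From mathcomp Require Import all_boot all_order all_algebra all_fingroup.
From mathcomp Require Import all_solvable all_field.
From mathcomp Require Import generic_quotient boolp mpoly ring.
Set Implicit Arguments.
Unset Strict Implicit.
Unset Printing Implicit Defensive.
Import GRing.Theory.
Local Open Scope ring_scope.
Local Open Scope quotient_scope.

(** * The q-power Frobenius as a ring morphism *)

(** The proof that [R] has characteristic [p] is an argument, so that the morphism instances below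
    can be inferred from the term itself. *)
Definition frob (R : comNzRingType) (p e : nat) (_ : p \in [pchar R]) (x : R) :
  R := x ^+ (p ^ e)%N.

Section FrobeniusMorphism.
Variables (R : comNzRingType) (p e : nat) (charR : p \in [pchar R]).

Lemma pchar_pnat : [pchar R].-nat (p ^ e)%N.
Proof.
by rewrite pnatX (eq_pnat _ (pcharf_eq charR)) pnat_id ?(pcharf_prime charR).
Qed.

Lemma expn_pchar_gt0 : (0 < p ^ e)%N.
Proof. by rewrite expn_gt0 prime_gt0 ?(pcharf_prime charR). Qed.

Fact frob_is_nmod_morphism : nmod_morphism (frob e charR).
Proof.
split=> [|x y]; first by rewrite /frob expr0n eqn0Ngt expn_pchar_gt0.
exact/exprDn_pchar/pchar_pnat.
Qed.

Fact frob_is_monoid_morphism : monoid_morphism (frob e charR).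
Proof. by split=> [|x y]; rewrite /frob ?expr1n ?exprMn. Qed.

HB.instance Definition _ :=
  GRing.isNmodMorphism.Build R R (frob e charR) frob_is_nmod_morphism.
HB.instance Definition _ :=
  GRing.isMonoidMorphism.Build R R (frob e charR) frob_is_monoid_morphism.

End FrobeniusMorphism.

(** * Lang's theorem for the general linear group over a closed field *)

Section ClosedFieldChar.
Variables (k : closedFieldType) (p e : nat) (chark : p \in [pchar k]).
Hypothesis e_gt0 : (0 < e)%N.
Local Notation q := (p ^ e)%N.
Local Notation f := (frob e chark).

Lemma expn_pchar_gt1 : (1 < q)%N.
Proof. by rewrite (ltn_exp2l 0) // prime_gt1 // (pcharf_prime chark). Qed.
Let q_gt1 := expn_pchar_gt1.
Let q_gt0 : (0 < q)%N := ltnW q_gt1.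

Lemma expn_pchar_eq0 : q%:R = 0 :> k.
Proof. by rewrite -(prednK e_gt0) expnS natrM (pcharf0 chark) mul0r. Qed.

Lemma closed_root_expn (c : k) m : (0 < m)%N -> exists x : k, x ^+ m = c.
Proof.
move=> m_gt0; have: size ('X^m - c%:P) != 1%N.
  by rewrite size_XnsubC // eqSS -lt0n.
case/closed_rootP=> x; rewrite rootE !hornerE subr_eq0 => /eqP <-.
by exists x.
Qed.

(** Since q > 1 and a is nonzero, a X^q - X + c has degree q, hence a root. *)
Lemma artin_schreier_root (a c : k) : a != 0 -> exists x, x = a * x ^+ q + c.
Proof.
move=> a0; have: size (a *: 'X^q - ('X - c%:P)) != 1%N.
  rewrite size_polyDl ?size_scale ?size_polyXn ?size_polyN ?size_XsubC //.
  by rewrite -lt0n.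
case/closed_rootP=> x; rewrite rootE !hornerE subr_eq0 => /eqP xq.
by exists x; rewrite xq subrK.
Qed.

(* Solving v = phi(v) for v = sum_i x_i w_i, where phi is semilinear,
   phi(w_i) = w_(i+1) and w_(m+1) = sum_i b_i w_i, expresses each x_i as an
   additive polynomial in the unknown x_m. *)
Fixpoint additive_poly (b : nat -> k) i : {poly k} :=
  if i is j.+1 then additive_poly b j ^+ q + b i *: 'X^q else b 0%N *: 'X^q.

Lemma deriv_additive_poly b i : (additive_poly b i)^`() = 0.
Proof.
have q0 (P : {poly k}) : P *+ q = 0.
  by rewrite -mulr_natr -polyC_natr expn_pchar_eq0 mulr0.
case: i => [|i] /=; rewrite ?derivD derivZ derivXn ?derivX ?deriv_exp !q0.
  by rewrite scaler0.
by rewrite scaler0 addr0.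
Qed.

Lemma dvdp_additive_poly b i : ('X^q %| additive_poly b i)%R.
Proof.
elim: i => [|i IHi] /=; first by rewrite -mul_polyC dvdp_mulIr.
rewrite dvdp_add // -?mul_polyC ?dvdp_mulIr //.
by rewrite (dvdp_trans IHi) // -{1}[additive_poly b i]expr1 dvdp_exp2l.
Qed.

(** The q-th power of a multiple of X^q has no term of degree q, so the coefficient of X^q at index
    i is [b i]. The coefficients are peeled off from the top. *)
Lemma additive_poly_eq0 b i :
  additive_poly b i = 0 -> forall j, (j <= i)%N -> b j = 0.
Proof.
elim: i => [|i IHi] /= Y0 j.
  rewrite leqn0 => /eqP->.
  by have := congr1 (coefp q) Y0; rewrite /= coefZ coefXn eqxx mulr1 coef0.
have bi : b i.+1 = 0.
  have := congr1 (coefp q) Y0; rewrite /= coefD coefZ coefXn eqxx mulr1 coef0.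
  have /dvdpP[R ->] := dvdp_additive_poly b i.
  by rewrite exprMn -exprM coefMXn ltn_Pmull // add0r.
move: Y0; rewrite bi scale0r addr0 => /eqP.
rewrite expf_eq0 q_gt0 => /eqP /IHi b0.
by rewrite leq_eqVlt => /predU1P[->|/b0].
Qed.

(* additive_poly b m - X has derivative -1, so 0 is a simple root and another
   root exists. *)
Lemma additive_recursion (b : nat -> k) m i : (i <= m)%N -> b i != 0 ->
  exists x : nat -> k, [/\ x m != 0, x 0%N = b 0%N * x m ^+ q
    & forall j, x j.+1 = x j ^+ q + b j.+1 * x m ^+ q].
Proof.
move=> im bi; pose P := additive_poly b m - 'X.
have root0 : root P 0.
  have /dvdpP[R YE] := dvdp_additive_poly b m.
  by rewrite rootE !hornerE YE !hornerE expr0n eqn0Ngt q_gt0 mulr0 subrr.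
have /factor_theorem[R] := root0; rewrite subr0 => PE.
have dP : R^`() * 'X + R = - 1.
  rewrite -[R in _ + R]mulr1 -derivX -derivM -PE derivB deriv_additive_poly.
  by rewrite derivX sub0r.
(* A constant [R] would be -1, so [additive_poly b m] would vanish, and with it every [b j] for j <=
   m. *)
have Rroot : size R != 1%N.
  apply/negP=> /size_poly1P[c _ RE]; case/eqP: bi.
  apply: additive_poly_eq0 im; move: dP; rewrite RE derivC mul0r add0r => cE.
  by move: PE; rewrite RE cE mulN1r => /eqP; rewrite subr_eq addNr => /eqP.
have /closed_rootP[r rR] := Rroot.
have r0 : r != 0.
  apply: contraTneq rR => ->; rewrite rootE.
  have := congr1 (fun Q => Q.[0]) dP; rewrite /= !hornerE => ->.
  by rewrite oppr_eq0 oner_eq0.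
have Yr : (additive_poly b m).[r] = r.
  have : root P r by rewrite PE rootM rR.
  by rewrite rootE !hornerE subr_eq0 => /eqP.
exists (fun i => (additive_poly b i).[r]); rewrite Yr.
by split=> //= [|j]; rewrite !hornerE.
Qed.

(** Iterating the semilinear map from a nonzero vector yields a first linear dependency; the fixed
    vector is sought in the span of the iterates before it. *)
Lemma frob_fixed_vector n (M : 'M[k]_n.+1) : M \in unitmx ->
  exists2 v : 'cV_n.+1, v != 0 & M *m map_mx f v = v.
Proof.
move=> uM; pose phi (u : 'cV[k]_n.+1) := M *m map_mx f u.
pose w i := iter i phi (const_mx 1).
have w_neq0 i : w i != 0.
  elim: i => [|i]; last first.
    apply: contraNneq => /(congr1 (mulmx (invmx M))).
    by rewrite /= mulKmx // mulmx0 => /eqP; rewrite map_mx_eq0.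
  by apply/eqP=> /matrixP/(_ 0 0)/eqP; rewrite !mxE oner_eq0.
have wS i : M *m map_mx f (w i) = w i.+1 by [].
clearbody w; have exm : exists m, ~~ free (mkseq w m.+1).
  exists n.+1; apply/negP; rewrite /free size_mkseq => /eqP dimX.
  have := dimvS (subvf <<mkseq w n.+2>>%VS); rewrite dimX dimvf dim_matrix.
  by rewrite [(_ * 1)%R]muln1 ltnn.
(* First dependency: w_0, ..., w_m is free and w_(m+1) lies in its span. Index 0 is excluded because
   w_0 is nonzero. *)
case: (ex_minnP exm) => -[|m]; first by rewrite seq1_free w_neq0.
have free_mkseqS j : free (mkseq w j.+1) =
    (w j \notin <<mkseq w j>>%VS) && free (mkseq w j).
  rewrite mkseqS (@perm_free _ _ _ (w j :: mkseq w j)) ?perm_rcons //.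
  by rewrite free_cons.
move=> nfree min_m.
have freeX : free (mkseq w m.+1).
  by apply: contraT => /min_m; rewrite ltnn.
move: nfree; rewrite free_mkseqS freeX andbT negbK => wm.
pose T := @Tuple m.+1 _ (mkseq w m.+1) (introT eqP (size_mkseq w m.+1)).
pose b i : k := coord T (inord i) (w m.+1).
have wE : w m.+1 = \sum_(i < m.+1) b i *: w i.
  rewrite {1}(coord_span (X := T) wm); apply: eq_bigr => i _.
  by rewrite /b inord_val nth_mkseq.
(* The semilinear map is injective, so w_(m+1) is nonzero and some coefficient survives, as
   [additive_recursion] requires. *)
have [i im bi] : exists2 i, (i <= m)%N & b i != 0.
  have [/existsP[i bi]|/existsPn b0] := boolP [exists i : 'I_m.+1, b i != 0].
    by exists i; rewrite // -ltnS.
  case/eqP: (w_neq0 m.+1); rewrite wE big1 // => i _.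
  by move: (b0 i); rewrite negbK => /eqP->; rewrite scale0r.
have [x [xm x0 xS]] := additive_recursion im bi.
exists (\sum_(i < m.+1) x i *: w i).
  have /freeP fX : free T by [].
  apply: contra_neq xm => v0; apply: (fX (fun i => x i) _ ord_max).
  by rewrite -[RHS]v0; apply: eq_bigr => j _; rewrite nth_mkseq.
have phiE : M *m map_mx f (\sum_(i < m.+1) x i *: w i) =
    \sum_(i < m.+1) x i ^+ q *: w i.+1.
  rewrite raddf_sum mulmx_sumr; apply: eq_bigr => j _.
  by rewrite /= map_mxZ -scalemxAr wS.
(* Expanding w_(m+1) and shifting the index, the coefficients of each w_j agree by the recursion for
   x. *)
rewrite phiE big_ord_recr /= wE scaler_sumr big_ord_recl [RHS]big_ord_recl /=.
rewrite addrCA x0 scalerA [x m ^+ q * _]mulrC; congr (_ + _).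
rewrite -big_split; apply: eq_bigr => j _ /=.
by rewrite /bump /= add1n xS scalerDl scalerA [x m ^+ q * _]mulrC.
Qed.

(** In the rank factorization of a nonzero column the middle factor is the first basis column, and
    the right factor is an invertible 1 x 1 matrix that [P] absorbs as a scalar. *)
Lemma unit_first_column (F : fieldType) n (v : 'cV[F]_(1 + n)) : v != 0 ->
  exists2 P : 'M_(1 + n), P \in unitmx & P *m col_mx 1%:M 0 = v.
Proof.
move=> v0; have rv : \rank v = 1%N.
  by apply/eqP; rewrite eqn_leq rank_leq_col lt0n mxrank_eq0.
exists (col_ebase v *m (row_ebase v 0 0)%:M).
  rewrite unitmx_mul col_ebase_unit unitmxE det_scalar.
  have := row_ebase_unit v; rewrite unitmxE det_mx11 => u.
  by rewrite unitrX.
rewrite -[RHS]mulmx_ebase rv [row_ebase v in RHS]mx11_scalar -!mulmxA.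
congr (_ *m _); rewrite mul_scalar_mx mul_mx_scalar; congr (_ *: _).
by rewrite pid_mx_col.
Qed.

(** Induction on n. With a fixed vector as first basis vector, [M] becomes block upper triangular
    with corner 1. The induction hypothesis solves the lower block, and one Artin-Schreier equation
    per entry solves the top row. *)
Lemma lang_GL n (M : 'M[k]_n) : M \in unitmx ->
  exists2 C : 'M_n, C \in unitmx & M *m map_mx f C = C.
Proof.
elim: n M => [|n IHn] M uM.
  by exists 1%:M; [exact: unitmx1 | apply/matrixP=> -[]].
have [v v0 fixv] := frob_fixed_vector uM.
have [P uP Pe] := @unit_first_column _ n v v0.
(* The matrix of the same semilinear map in the basis [P]: a solution [S] for [M'] gives the
   solution [P *m S] for [M]. *)
pose M' : 'M_(1 + n) := invmx P *m (M *m map_mx f P).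
have uM' : M' \in unitmx by rewrite !unitmx_mul unitmx_inv uP uM map_unitmx.
have e0E : map_mx f (col_mx 1%:M 0 : 'cV[k]_(1 + n)) = col_mx 1%:M 0.
  by rewrite map_col_mx map_mx1 map_mx0.
have M'e : M' *m col_mx 1%:M 0 = col_mx 1%:M 0.
  have fixe : M *m (map_mx f P *m col_mx 1%:M 0) = P *m col_mx 1%:M 0.
    by rewrite -{1}e0E -map_mxM Pe.
  by rewrite /M' -!mulmxA fixe mulKmx.
pose b := ursubmx M'; pose M1 := drsubmx M'.
have M'E : M' = block_mx 1%:M b 0 M1.
  move: M'e; rewrite -{1 2}[M']submxK mul_block_col !mulmx1 !mulmx0 !addr0.
  by case/eq_col_mx=> -> ->.
have uM1 : M1 \in unitmx.
  by move: uM'; rewrite M'E unitmxE det_ublock det1 mul1r -unitmxE.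
have [C1 uC1 C1E] := IHn _ uM1.
have [s sE] : exists s : 'rV[k]_n, s = map_mx f s + b *m map_mx f C1.
  have ex_s j : exists x, x == x ^+ q + (b *m map_mx f C1) 0 j.
    have [x xE] := artin_schreier_root ((b *m map_mx f C1) 0 j) (oner_neq0 k).
    by exists x; rewrite {1}xE mul1r.
  have [s sE] : exists s, forall j, s j = s j ^+ q + (b *m map_mx f C1) 0 j.
    by exists (fun j => xchoose (ex_s j)) => j; apply/eqP/(xchooseP (ex_s j)).
  exists (\row_j s j); apply/rowP=> j.
  by rewrite [LHS]mxE sE [RHS]mxE; congr (_ + _); rewrite !mxE.
pose S := block_mx 1%:M s 0 C1.
have uS : S \in unitmx by rewrite unitmxE det_ublock det1 mul1r -unitmxE.
have SE : M' *m map_mx f S = S.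
  rewrite M'E map_block_mx map_mx1 map_mx0 mulmx_block !mul1mx !mul0mx.
  by rewrite !mulmx0 !addr0 !add0r C1E -sE.
exists (P *m S); first by rewrite unitmx_mul uP.
by rewrite map_mxM mulmxA -[M *m _](mulKVmx uP) -/M' -mulmxA; congr (_ *m _).
Qed.

End ClosedFieldChar.

(** * Orthonormal bases for Frobenius-sesquilinear forms *)

Section HermitianForms.
Variables (k : closedFieldType) (p e : nat) (chark : p \in [pchar k]).
Hypothesis e_gt0 : (0 < e)%N.
Local Notation q := (p ^ e)%N.
Local Notation f := (frob e chark).

(** The conjugate transpose for the conjugation x |-> x^q. Applied twice it is the q^2-Frobenius on
    entries, which is the identity only on matrices over F_{q^2}. *)
Definition frob_trmx m n (A : 'M[k]_(m, n)) : 'M_(n, m) := (map_mx f A)^T.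

Local Notation frobT := frob_trmx.

Lemma frobTM m n l (A : 'M[k]_(m, n)) (B : 'M_(n, l)) :
  frobT (A *m B) = frobT B *m frobT A.
Proof. by rewrite /frob_trmx map_mxM trmx_mul. Qed.

Lemma frobTD m n (A B : 'M[k]_(m, n)) : frobT (A + B) = frobT A + frobT B.
Proof. by rewrite /frob_trmx map_mxD linearD. Qed.

Lemma frobTZ m n a (A : 'M[k]_(m, n)) : frobT (a *: A) = a ^+ q *: frobT A.
Proof. by rewrite /frob_trmx map_mxZ linearZ. Qed.

Lemma frobT1 n : frobT (1%:M : 'M[k]_n) = 1%:M.
Proof. by rewrite /frob_trmx map_mx1 trmx1. Qed.

Lemma frobT_unit n (A : 'M[k]_n) : (frobT A \in unitmx) = (A \in unitmx).
Proof. by rewrite unitmx_tr map_unitmx. Qed.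

Lemma frobT_block m1 m2 n1 n2 (A : 'M[k]_(m1, n1)) (B : 'M_(m1, n2))
    (C : 'M_(m2, n1)) (D : 'M_(m2, n2)) :
  frobT (block_mx A B C D) = block_mx (frobT A) (frobT C) (frobT B) (frobT D).
Proof. by rewrite /frob_trmx map_block_mx tr_block_mx. Qed.

Lemma frobTK m n (A : 'M[k]_(m, n)) :
  frobT (frobT A) = map_mx (frob (e * 2) chark) A.
Proof.
by apply/matrixP=> i j; rewrite !mxE /frob -exprM -expnD addnn -muln2.
Qed.

Local Notation frob2 := (map_mx (frob (e * 2) chark)).

Lemma form_delta n (A : 'M[k]_n) i j :
  frobT (delta_mx i 0) *m A *m delta_mx j 0 = (A i j)%:M :> 'M_1.
Proof.
rewrite /frob_trmx map_delta_mx trmx_delta -rowE -colE.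
by apply/matrixP=> a b; rewrite !ord1 !mxE.
Qed.

(* If the diagonal vanishes, H i j != 0 is used through a scalar y of
   trace y + y^q = 1. *)
Lemma hermitian_nonisotropic n (H : 'M[k]_n) : frobT H = H -> H != 0 ->
  exists2 w : 'cV_n, frob2 w = w & frobT w *m H *m w != 0.
Proof.
move=> herH H0.
have fix_delta (i : 'I_n) : frob2 (delta_mx i 0) = delta_mx i 0 :> 'cV[k]_n.
  exact: map_delta_mx.
have [/existsP[i Hi]|/existsPn diag0] := boolP [exists i, H i i != 0].
  exists (delta_mx i 0); rewrite // form_delta -scalemx1 scaler_eq0 negb_or Hi.
  by rewrite oner_eq0.
have [i [j Hij]] : exists i j, H i j != 0.
  have [/existsP[i /existsP[j Hij]]|] := boolP [exists i, exists j, H i j != 0].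
    by exists i, j.
  rewrite negb_exists => /forallP all0; case/eqP: H0; apply/matrixP=> i j.
  by have /existsPn/(_ j) := all0 i; rewrite negbK mxE => /eqP.
have Hii i' : H i' i' = 0 by apply/eqP; move: (diag0 i'); rewrite negbK.
have HjiE : H j i = H i j ^+ q by rewrite -{1}herH !mxE.
have HijE : H i j = H j i ^+ q by rewrite -{1}herH !mxE.
have [y yE] : exists y : k, y = - 1 * y ^+ q + 1.
  by apply: (artin_schreier_root chark e_gt0); rewrite oppr_eq0 oner_eq0.
have yqE : y ^+ q = 1 - y by rewrite {2}yE mulN1r opprD opprK addrC subrK.
have frob2E x : frob (e * 2) chark x = (x ^+ q) ^+ q.
  by rewrite -exprM -expnD addnn -muln2.
(* At this vector the form takes the value y + y^q = 1, because [H j i] is the q-th power of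
   [H i j]. *)
exists (delta_mx i 0 + (y / H i j) *: delta_mx j 0).
  rewrite map_mxD map_mxZ !fix_delta; congr (_ + _ *: _).
  rewrite /= frob2E !expr_div_n -HjiE -HijE yqE; congr (_ / _).
  by rewrite -[LHS]/(f (1 - y)) rmorphB rmorph1 /= /frob yqE opprB addrC subrK.
rewrite frobTD frobTZ mulmxDl !mulmxDr !mulmxDl.
rewrite -!scalemxAl -!scalemxAr !form_delta !Hii HjiE !scale_scalar_mx.
rewrite -exprMn divfK // !mulr0 yqE -!raddfD /= add0r addr0 subrK.
exact: oner_neq0.
Qed.

(** Gram-Schmidt, splitting off one vector of value 1 at a time. The statement ranges over all
    invertible [A], so that induction applies directly to the complementary block. *)
Lemma orthonormal_basis n (A : 'M[k]_n) : A \in unitmx ->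
  exists2 B : 'M_n, B \in unitmx & frobT B *m A *m B = 1%:M.
Proof.
elim: n A => [|n IHn] A uA.
  by exists 1%:M; [exact: unitmx1 | apply/matrixP=> -[]].
have uN : invmx A *m frobT A \in unitmx.
  by rewrite unitmx_mul unitmx_inv uA frobT_unit.
have e2_gt0 : (0 < e * 2)%N by rewrite muln_gt0 e_gt0.
(* The columns of [C] are fixed by the semilinear map attached to [A]; this is exactly what makes
   the Gram matrix [H] Hermitian. *)
have [C uC /(congr1 (mulmx A))] := lang_GL chark e2_gt0 uN.
rewrite -mulmxA mulKVmx // => CE.
pose H := frobT C *m A *m C.
have herH : frobT H = H by rewrite /H !frobTM frobTK CE mulmxA.
have H0 : H != 0.
  have uH : H \in unitmx by rewrite !unitmx_mul frobT_unit uC uA.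
  by apply: contraTneq uH => ->; rewrite unitmxE det0 unitr0.
have [w fixw wH] := hermitian_nonisotropic herH H0.
pose v := C *m w; pose a := (frobT v *m A *m v) 0 0.
have vE : frobT v *m A *m v = a%:M by exact: mx11_scalar.
have a0 : a != 0.
  apply: contra_neq wH => a0; have <- : frobT v *m A *m v = 0.
    by rewrite vE a0 raddf0.
  by rewrite /v /H frobTM !mulmxA.
have Av : frobT A *m frob2 v = A *m v.
  by rewrite map_mxM fixw !mulmxA CE.
clearbody v.
(* As v is fixed, a lies in F_q, so l below lies in F_{q^2}. *)
have aq : a ^+ q = a.
  have := congr1 (fun M => frobT M 0 0) vE.
  by rewrite !frobTM frobTK Av mulmxA vE !mxE eqxx !mulr1n => /esym.
have [l lE] := @closed_root_expn k a^-1 q.+1 isT.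
have l2 : frob (e * 2) chark l = l.
  have l0 : l != 0.
    by apply: contra_neq a0 => l0; move: lE; rewrite l0 expr0n /= => /esym/eqP;
      rewrite invr_eq0 => /eqP.
  have lq : l ^+ q = (a * l)^-1 by rewrite invfM -lE exprSr mulfK.
  rewrite /frob muln2 -addnn expnD exprM lq exprVn exprMn aq lq invfM invrK.
  by rewrite mulrA mulVf // mul1r.
pose u := l *: v.
have uE : frobT u *m A *m u = 1%:M.
  rewrite frobTZ -!scalemxAl -scalemxAr vE !scale_scalar_mx mulrA -exprSr lE.
  by rewrite mulVf.
have Au : frobT A *m frob2 u = A *m u.
  by rewrite map_mxZ /= l2 -!scalemxAr Av.
have u0 : u != 0.
  apply/eqP=> u0; move: uE; rewrite u0 mulmx0 => /eqP; rewrite eq_sym.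
  exact/negP/oner_neq0.
have [P uP Pe] := @unit_first_column k n u u0.
pose e0 : 'cV[k]_(1 + n) := col_mx 1%:M 0.
pose A' : 'M_(1 + n) := frobT P *m A *m P.
have uA' : A' \in unitmx by rewrite !unitmx_mul frobT_unit uP uA.
pose b := ursubmx A'.
have eAe : frobT e0 *m A' *m e0 = 1%:M.
  by rewrite -uE -Pe /A' frobTM !mulmxA.
(* The fixed-vector equation for u in the new basis. It forces the lower left block of [A'] to be
   the conjugate transpose of the upper right one. *)
have A'e : frobT A' *m e0 = A' *m e0.
  have fe0 : frob2 e0 = e0 by rewrite map_col_mx map_mx1 map_mx0.
  have Pfe : frob2 P *m e0 = frob2 u by rewrite -{1}fe0 -map_mxM Pe.
  by rewrite /A' !frobTM frobTK -!mulmxA Pfe Au Pe.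
have blockE (x : 'M_1) y z (t : 'M_n) :
    A' = block_mx x y z t -> x = 1%:M /\ z = frobT y.
  move=> A'E; move: eAe A'e; rewrite A'E frobT_block !mul_block_col.
  rewrite /frob_trmx map_col_mx tr_col_mx map_mx1 map_mx0 trmx1 trmx0.
  rewrite mul_row_block !mul1mx !mul0mx !addr0 mul_row_col.
  rewrite !mulmx1 !mulmx0 !addr0.
  by move=> -> /eq_col_mx[_ ->].
have [aE cE] := blockE _ _ _ _ (esym (submxK A')).
have A'E : A' = block_mx 1%:M b (frobT b) (drsubmx A').
  by rewrite -[LHS]submxK aE cE.
(* Completing the square. *)
pose d := drsubmx A' - frobT b *m b.
pose S : 'M[k]_(1 + n) := block_mx 1%:M (- b) 0 1%:M.
have uS : S \in unitmx by rewrite unitmxE det_ublock !det1 mul1r unitr1.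
pose D (X : 'M[k]_n) : 'M[k]_(1 + n) := block_mx 1%:M 0 0 X.
have uD X : (D X \in unitmx) = (X \in unitmx).
  by rewrite unitmxE det_ublock det1 mul1r -unitmxE.
have SA'S : frobT S *m A' *m S = D d.
  rewrite A'E frobT_block /frob_trmx raddfN linearN.
  rewrite map_mx0 !map_mx1 trmx0 !trmx1.
  rewrite !mulmx_block !mul1mx !mul0mx !mulmx1 !mulmx0 !addr0.
  by rewrite !mulNmx !mul1mx !addNr mul0mx add0r addrC.
have ud : d \in unitmx by rewrite -uD -SA'S 2!unitmx_mul frobT_unit uS uA'.
have [B1 uB1 B1E] := IHn _ ud.
have TdT : frobT (D B1) *m D d *m D B1 = 1%:M.
  rewrite frobT_block /frob_trmx !map_mx0 map_mx1 !trmx0 trmx1 !mulmx_block.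
  rewrite !mul1mx !mul0mx !mulmx0 !addr0 !add0r B1E.
  by rewrite mul1mx !mul0mx -scalar_mx_block.
exists (P *m S *m D B1); first by rewrite !unitmx_mul uP uS uD.
by rewrite -TdT -SA'S /A' !frobTM !mulmxA.
Qed.

End HermitianForms.

(** * Frobenius forms and their matrices *)

Section FrobeniusForms.
Variables (k : closedFieldType) (p e n : nat) (chark : p \in [pchar k]).
Hypothesis e_gt0 : (0 < e)%N.
Local Notation q := (p ^ e)%N.
Local Notation frobT := (frob_trmx e chark).

Lemma dhomog1E (P : {mpoly k[n]}) :
  P \is 1.-homog -> P = \sum_j P@_U_(j) *: 'X_j.
Proof.
move=> homP; apply/mpolyP=> m; rewrite raddf_sum /=.
under eq_bigr do rewrite mcoeffZ mcoeffX.
have [/mdeg1P[i /eqP ->]|m1] := boolP (mdeg m == 1%N).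
  rewrite (bigD1 i) //= eqxx mulr1 big1 ?addr0 // => j ji.
  by rewrite eq_mnm1 (negPf ji) mulr0.
rewrite (dhomog_nemf_coeff homP m1) big1 // => j _.
case: eqP => [mE|_]; last by rewrite mulr0.
by rewrite -mE mdeg1 in m1.
Qed.

(** Row i of [A] holds the coefficients of [L i]. As q = 0 in k, the factors X_i^q have zero
    derivative, so only the linear factors contribute to the gradient. *)
Lemma frobenius_form_mx (F : {mpoly k[n]}) : frobenius_form q F ->
  exists A : 'M[k]_n,
    (forall v, eval_at F v = (frobT v *m A *m v) 0 0)
    /\ (forall v j, eval_at F^`M(j) v = (frobT v *m A) 0 j).
Proof.
case=> L homL ->; exists (\matrix_(i, j) (L i)@_U_(j)); split=> [v|v j].
  rewrite /eval_at raddf_sum -mulmxA mxE; apply: eq_bigr => i _ /=.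
  rewrite !mxE mevalM rmorphXn /= mevalXU {1}(dhomog1E (homL i)); congr (_ * _).
  rewrite raddf_sum /=; apply: eq_bigr => j _.
  by rewrite mevalZ mevalXU mxE.
rewrite /eval_at (raddf_sum (mderiv j)) raddf_sum mxE /=; apply: eq_bigr => i _.
rewrite !mxE mderivM mpolyXn mderivX mulmnE mulnC natrM.
rewrite (expn_pchar_eq0 chark e_gt0) mul0r scale0r mul0r add0r.
rewrite mevalM -mpolyXn rmorphXn /= mevalXU {1}(dhomog1E (homL i)).
congr (_ * _); rewrite (raddf_sum (mderiv j)) raddf_sum /= (bigD1 j) //=.
rewrite big1 ?addr0 => [|l lj].
  rewrite mderivZ mderivX mnm1E eqxx scale1r -[X in (X - _)%MM]add0m addmK.
  by rewrite mpolyX0 mevalZ meval1 mulr1.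
by rewrite mderivZ mderivX mnm1E (negPf lj) scale0r scaler0 meval0.
Qed.

(** The entrywise q-th root of a nonzero vector in the left kernel of [A] would be a singular
    point. *)
Lemma smooth_frobenius_form_unit (F : {mpoly k[n]}) (A : 'M[k]_n) :
    (forall v, eval_at F v = (frobT v *m A *m v) 0 0) ->
    (forall v j, eval_at F^`M(j) v = (frobT v *m A) 0 j) ->
  smooth_hypersurface F -> A \in unitmx.
Proof.
move=> evF evdF smF; rewrite -row_free_unit -kermx_eq0.
apply: contraT => /rowV0Pn[w /sub_kermxP wA w0].
have ex_root i : exists x : k, x ^+ q == w 0 i.
  have [x xq] := closed_root_expn (w 0 i) (expn_pchar_gt0 e chark).
  by exists x; apply/eqP.
pose v : 'cV_n := \col_i xchoose (ex_root i).
have fv : frobT v = w.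
  by apply/rowP=> i; rewrite !mxE; apply/eqP/(xchooseP (ex_root i)).
have v0 : v != 0.
  by apply: contra_neq w0 => v0; rewrite -fv v0 /frob_trmx map_mx0 trmx0.
case: (smF (NzVec v0)) => [|i]; rewrite ?evF ?evdF /= fv wA ?mul0mx ?mxE //.
by rewrite eqxx.
Qed.

Lemma form_scale (A : 'M[k]_n) c (v : 'cV_n) :
  (frobT (c *: v) *m A *m (c *: v)) 0 0
    = c ^+ q.+1 * (frobT v *m A *m v) 0 0.
Proof. by rewrite frobTZ -!scalemxAl -scalemxAr scalerA mxE exprSr. Qed.

Lemma zero_locus_form (F : {mpoly k[n]}) (A : 'M[k]_n) (v : nzvec k n) :
    (forall v, eval_at F v = (frobT v *m A *m v) 0 0) ->
  zero_locus F (\pi_(proj k n) v)%qT <-> frobT v *m A *m v = 0.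
Proof.
move=> evF; split=> [Fv|Fv u /esym/eqP/projP[c _ ->]].
  by rewrite [LHS]mx11_scalar -evF Fv // raddf0.
by rewrite evF form_scale Fv mxE mulr0.
Qed.

(* On the line through two coordinate points the Fermat form restricts to
   1 + t^(q+1), which has q + 1 distinct roots, whereas the difference of the
   two forms restricts to a polynomial of degree at most q. *)
Lemma form_vanishing_on_fermat (M : 'M[k]_n) : (2 <= n)%N ->
    (forall v : 'cV_n, frobT v *m v = 0 -> frobT v *m M *m v = 0) ->
  exists c, M = c%:M.
Proof.
move=> n_ge2 vanM.
have lineE (N : 'M[k]_n) (i j : 'I_n) t
    (v := delta_mx i 0 + t *: delta_mx j 0) :
    frobT v *m N *m v
      = (N i i + t * N i j + t ^+ q * N j i + t ^+ q.+1 * N j j)%:M :> 'M_1.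
  rewrite frobTD frobTZ mulmxDl !mulmxDr !mulmxDl -!scalemxAl -!scalemxAr.
  rewrite !form_delta !scale_scalar_mx -!raddfD /=; congr (_%:M).
  rewrite [t ^+ q * (t * _)]mulrA -exprSr -!addrA; congr (_ + _).
  by rewrite addrCA.
have pair (i j : 'I_n) : i != j -> M i i = M j j /\ M i j = 0.
  move=> ij; pose P : {poly k} := 'X^(q.+1) - (- 1)%:P.
  (* The form of [M] on the line, with t^(q+1) replaced by its value -1 at the roots of [P]. *)
  pose R : {poly k} := (M i i - M j j)%:P + M i j *: 'X + M j i *: 'X^q.
  have q_gt1 := expn_pchar_gt1 chark e_gt0.
  have [rs PE] := closed_field_poly_normal P.
  have sizeP : size P = q.+2 by rewrite size_XnsubC.
  have monP : lead_coef P = 1 by apply/eqP/monicXnsubC.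
  rewrite monP scale1r in PE.
  (* The derivative of [P] is (q + 1) X^q = X^q, coprime to [P] because P(0) = 1. *)
  have uniq_rs : uniq rs.
    rewrite -separable_prod_XsubC -PE separable_poly.unlock.
    rewrite derivB derivC subr0 derivXn mulrS -mulr_natr -polyC_natr.
    rewrite (expn_pchar_eq0 chark e_gt0) mulr0 addr0.
    rewrite coprimep_expr // coprimepX rootE !hornerE expr0n /= opprK add0r.
    exact: oner_neq0.
  have size_rs : size rs = q.+1.
    by apply: succn_inj; rewrite -sizeP PE size_prod_XsubC.
  have rootR : all (root R) rs.
    apply/allP=> t; rewrite -root_prod_XsubC -PE rootE !hornerE opprK addr_eq0.
    move/eqP=> tq; have /= := lineE M i j t; rewrite vanM; last first.
      have /= := lineE 1%:M i j t; rewrite mulmx1 => ->.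
      rewrite !mxE !eqxx [j == i]eq_sym (negPf ij) !mulr0 !addr0 tq mulN1r.
      by rewrite subrr raddf0.
    move=> /(congr1 (fun N : 'M_1 => N 0 0)); rewrite !mxE mulr1n => /esym vt.
    rewrite rootE !hornerE; apply/eqP; rewrite -[RHS]vt tq; ring.
  have sizeR : (size R <= q.+1)%N.
    rewrite (leq_trans (size_polyD _ _)) // geq_max.
    apply/andP; split; last first.
      by rewrite (leq_trans (size_scale_leq _ _)) ?size_polyXn.
    rewrite (leq_trans (size_polyD _ _)) // geq_max size_polyC.
    rewrite (leq_trans (leq_b1 _)) //= (leq_trans (size_scale_leq _ _)) //.
    by rewrite size_polyX ltnW.
  have R0 : R = 0.
    apply/eqP; apply: contraTT sizeR => R0.
    by rewrite -ltnNge -size_rs max_poly_roots.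
  (* As q > 1, the degrees 0, 1 and q do not collide. *)
  have := congr1 (coefp 1) R0; have := congr1 (coefp 0) R0.
  rewrite /= !coefE /= (ltn_eqF q_gt1) (ltn_eqF (ltnW q_gt1)).
  by rewrite !mulr0 !addr0 add0r mulr1 => /eqP; rewrite subr_eq0 => /eqP.
pose i0 : 'I_n := Ordinal (ltnW n_ge2).
exists (M i0 i0); apply/matrixP=> i j; rewrite mxE.
have [<-|ij] := eqVneq i j; last by case: (pair i j ij).
by have [->|/pair[]] := eqVneq i i0.
Qed.

End FrobeniusForms.

(** * Finite fields: generators and embeddings into a closed field *)

Lemma finField_generator (L : finFieldType) :
  exists z : L, (#|L|.-1).-primitive_root z
    /\ forall x, x != 0 -> exists i, x = z ^+ i.
Proof.
have L_gt0 : (0 < #|L|.-1)%N by rewrite -subn1 subn_gt0 finRing_gt1.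
have expL (x : L) : x != 0 -> x ^+ #|L|.-1 = 1.
  move=> x0; apply: (mulfI x0).
  by rewrite mulr1 -exprS prednK ?expf_card // ltnW // finRing_gt1.
pose rs := enum (predC1 (0 : L)).
have all_rs : all (#|L|.-1).-unity_root rs.
  by apply/allP=> x; rewrite mem_enum unity_rootE => /expL->.
have size_rs : (#|L|.-1 <= size rs)%N by rewrite -cardE cardC1.
have /hasP[z _ prim_z] := has_prim_root L_gt0 all_rs (enum_uniq _) size_rs.
exists z; split=> // x /expL/(prim_rootP prim_z)[i ->].
by exists i.
Qed.

(* L = F_p(z) embeds by sending P(z) to P(r), where r is a root in k of the
   minimal polynomial of z. *)
Lemma finField_closed_embedding (L : finFieldType) (k : closedFieldType) p :
    p \in [pchar L] -> p \in [pchar k] ->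
  exists iota : {rmorphism L -> k},
    forall x, x ^+ #|L| = x -> exists y, iota y = x.
Proof.
move=> charL chark; have [z [_ genz]] := finField_generator L.
(* Both fields are viewed as algebras over the prime field. *)
pose M := pPrimeCharType charL; pose K := pPrimeCharType chark.
pose iL : {rmorphism 'F_p -> M} := GRing.in_alg M.
pose ik : {rmorphism 'F_p -> k} := (GRing.in_alg K : {rmorphism 'F_p -> K}).
pose evL P : L := (map_poly iL P).[z].
have /polyOver1P[mu muE] := minPolyOver 1%AS (z : M).
have [r rmu] : exists r, root (map_poly ik mu) r.
  apply/closed_rootP; rewrite size_map_poly -(size_map_poly iL) -muE.
  rewrite gtn_eqF // (root_size_gt1 _ (root_minPoly _ _)) //.
  by rewrite monic_neq0 ?monic_minPoly.
pose evk P : k := (map_poly ik P).[r].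
have evLk P : evL P = 0 -> evk P = 0.
  move=> /eqP PL; have : minPoly 1%AS (z : M) %| map_poly iL P.
    by apply: minPoly_dvdp => //; apply/polyOver1P; exists P.
  rewrite muE dvdp_map => /dvdpP[S ->].
  by rewrite /evk rmorphM hornerM (eqP rmu) mulr0.
have evLB P Q : evL (P - Q) = evL P - evL Q by rewrite /evL rmorphB !hornerE.
have evkB P Q : evk (P - Q) = evk P - evk Q by rewrite /evk rmorphB !hornerE.
have evLM P Q : evL (P * Q) = evL P * evL Q by rewrite /evL rmorphM !hornerE.
have evkM P Q : evk (P * Q) = evk P * evk Q by rewrite /evk rmorphM !hornerE.
have evL1 : evL 1 = 1 by rewrite /evL rmorph1 hornerC.
have evk1 : evk 1 = 1 by rewrite /evk rmorph1 hornerC.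
have surj x : exists P, evL P == x.
  have [->|/genz[i ->]] := eqVneq x 0.
    by exists 0; rewrite /evL rmorph0 horner0.
  by exists 'X^i; rewrite /evL map_polyXn hornerXn.
(* The chosen polynomial is immaterial: by [evLk], two polynomials that agree at z agree at r. *)
pose iota x := evk (xchoose (surj x)).
have iotaE P : iota (evL P) = evk P.
  apply/eqP; rewrite -subr_eq0 -evkB; apply/eqP/evLk.
  by rewrite evLB (eqP (xchooseP (surj (evL P)))) subrr.
have iotaB : zmod_morphism iota.
  move=> x y; have /eqP <- := xchooseP (surj x).
  have /eqP <- := xchooseP (surj y).
  by rewrite -evLB !iotaE.
have iotaM : monoid_morphism iota.
  split=> [|x y]; first by rewrite -evL1 iotaE evk1.
  have /eqP <- := xchooseP (surj x); have /eqP <- := xchooseP (surj y).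
  by rewrite -evLM !iotaE.
pose iota_zmod := GRing.isZmodMorphism.Build L k iota iotaB.
pose iota_monoid := GRing.isMonoidMorphism.Build L k iota iotaM.
pose j : {rmorphism L -> k} := HB.pack iota iota_zmod iota_monoid.
clearbody j; exists j => x xN.
(* Outside the image of [L], x would be one root too many for X^N - X with N = [#|L|]. *)
have [/mapP[y _ ->]|xj] := boolP (x \in map j (enum L)); first by exists y.
have N_gt1 : (1 < #|L|)%N := finRing_gt1 L.
pose P : {poly k} := 'X^#|L| - 'X.
have sizeP : size P = #|L|.+1.
  by rewrite size_polyDl size_polyXn // size_polyN size_polyX.
have P0 : P != 0 by rewrite -size_poly_eq0 sizeP.
have /(max_poly_roots P0) : all (root P) (x :: map j (enum L)).
  rewrite /= rootE !hornerE xN subrr eqxx; apply/allP=> _ /mapP[y _ ->].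
  by rewrite rootE !hornerE -rmorphXn expf_card subrr.
rewrite /= xj map_inj_uniq ?enum_uniq; last exact: fmorph_inj.
by move/(_ isT); rewrite size_map -cardE sizeP ltnn.
Qed.

(** * The center of the finite unitary group *)

Section UnitaryCenter.
Variables (n p e : nat) (L : finFieldType) (charL : p \in [pchar L]).
Hypothesis card_L : #|L| = ((p ^ e) ^ 2)%N.
Local Notation q := (p ^ e)%N.
Local Notation f := (frob e charL).
Local Notation U := (unitary_group n e charL).
Implicit Types (g h : {'GL_n[L]}) (A : 'M[L]_n.-1.+1).

Lemma GLval_inj : injective (@GLval n L).
Proof. exact: val_inj. Qed.

(** The size [n.-1.+1] is the one built into ['GL_n[L]]. *)
Lemma unitary_mx A : (map_mx f A)^T *m A = 1%:M ->
  exists2 g, g \in U & GLval g = A.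
Proof.
move=> uA; have [_ unitA] := mulmx1_unit uA.
by exists (FinRing.unit _ unitA) => //; rewrite inE; apply/eqP.
Qed.

Lemma scalar_unitary l : l ^+ q.+1 = 1 ->
  exists2 g, g \in U & GLval g = l%:M.
Proof.
move=> lq; apply: unitary_mx.
by rewrite map_scalar_mx tr_scalar_mx -scalar_mxM /= /frob -exprSr lq.
Qed.

(** The units of [L] form a cyclic group of order q^2 - 1 = (q - 1)(q + 1), so a power of a
    generator has order q + 1. *)
Lemma norm_one_generator : exists z : L, (q.+1).-primitive_root z.
Proof.
have [z [prim_z _]] := finField_generator L.
exists (z ^+ (#|L|.-1 %/ q.+1)); apply: dvdn_prim_root => //.
by rewrite card_L -subn1 -[X in (_ - X)%N](exp1n 2) subn_sqr addn1 dvdn_mull.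
Qed.

(** Commuting with the diagonal unitary matrices having a single entry z other than 1 kills the
    off-diagonal entries; commuting with transpositions equates the diagonal ones. *)
Lemma unitary_center_scalar g : g \in 'Z(U)%g -> exists l, GLval g = l%:M.
Proof.
case/centerP=> _ cg; have [z prim_z] := norm_one_generator.
have z1 : z != 1.
  rewrite -[z]expr1 -(prim_order_dvd prim_z) dvdn1 eqSS.
  by rewrite expn_eq0 negb_and -!lt0n prime_gt0 // (pcharf_prime charL).
have commE A : (map_mx f A)^T *m A = 1%:M -> GLval g *m A = A *m GLval g.
  by move=> /unitary_mx[h /cg /(congr1 GLval) + <-]; rewrite !GL_ME.
have offdiag i j : i != j -> GLval g i j = 0.
  move=> ij; pose d : 'rV_n.-1.+1 := \row_l if l == i then z else 1.
  have dd : (map_mx f (diag_mx d))^T *m diag_mx d = 1%:M.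
    rewrite map_diag_mx tr_diag_mx mulmx_diag -diag_const_mx; congr diag_mx.
    apply/rowP=> l; rewrite !mxE; case: ifP => _; last by rewrite rmorph1 mul1r.
    by rewrite /= /frob -exprSr prim_expr_order.
  have /matrixP/(_ i j) := commE _ dd.
  rewrite mul_mx_diag mul_diag_mx !mxE eqxx eq_sym (negPf ij) mulr1 => /eqP.
  rewrite -subr_eq0 -{1}[GLval g i j]mul1r -mulrBl mulf_eq0 subr_eq0 eq_sym.
  by rewrite (negPf z1) => /eqP.
have diag_eq i j : GLval g i i = GLval g j j.
  have tt : (map_mx f (tperm_mx i j))^T *m tperm_mx i j = 1%:M.
    by rewrite map_perm_mx tr_perm_mx -perm_mxM mulVg perm_mx1.
  have /matrixP/(_ i j) := commE _ tt.
  by rewrite -xcolE -xrowE !mxE tpermL tpermR.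
exists (GLval g 0 0); apply/matrixP=> i j; rewrite mxE.
by have [<-|/offdiag] := eqVneq i j; rewrite // (diag_eq i 0).
Qed.

Lemma scalar_unitary_center g l : g \in U -> GLval g = l%:M -> g \in 'Z(U)%g.
Proof.
move=> Ug gl; apply/centerP; split=> // h _; apply: GLval_inj.
by rewrite !GL_MxE gl scalar_mxC.
Qed.

Lemma unitary_centerE :
  'Z(U)%g = [set g | [exists l : L, (l ^+ q.+1 == 1) && (GLval g == l%:M)]].
Proof.
apply/setP=> g; rewrite [RHS]inE.
apply/idP/existsP=> [Zg|[l /andP[/eqP lq /eqP gl]]].
  have [l gl] := unitary_center_scalar Zg; exists l; rewrite gl eqxx andbT.
  have /centerP[+ _] := Zg; rewrite inE gl -[frob_mx _ _ _]/(map_mx f _).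
  rewrite map_scalar_mx tr_scalar_mx -scalar_mxM /= /frob -exprSr => /eqP.
  by move=> /matrixP/(_ 0 0); rewrite !mxE eqxx !mulr1n => ->.
have [h Uh hl] := scalar_unitary lq.
have -> : g = h by apply: GLval_inj; rewrite hl.
exact: scalar_unitary_center hl.
Qed.

(** The scalar matrix of a primitive (q+1)-th root of unity generates the center. *)
Lemma unitary_center_cyclic :
  cyclic 'Z(U)%g /\ #|'Z(U)%g| = q.+1.
Proof.
have [z prim_z] := norm_one_generator.
have [g _ gz] := scalar_unitary (prim_expr_order prim_z).
have gX i : GLval (g ^+ i)%g = (z ^+ i)%:M.
  rewrite -[GLval _]/(val _) FinRing.val_unitX -[val g]/(GLval g) gz.
  by rewrite rmorphXn.
have -> : 'Z(U)%g = <[g]>%g.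
  rewrite unitary_centerE; apply/setP=> h; rewrite inE.
  apply/existsP/cycleP=> [[l /andP[/eqP lq /eqP hl]]|[i ->]].
    have [i lE] := prim_rootP prim_z lq; exists i.
    by apply: GLval_inj; rewrite gX hl lE.
  exists (z ^+ i); rewrite gX eqxx andbT.
  by rewrite exprAC (prim_expr_order prim_z) expr1n.
split; first exact: cycle_cyclic.
have gX1 i : (g ^+ i == 1)%g = (z ^+ i == 1).
  rewrite -(inj_eq GLval_inj) gX.
  apply/eqP/eqP=> [|->] //.
  by move=> /matrixP/(_ 0 0); rewrite !mxE eqxx !mulr1n.
apply/eqP; rewrite eqn_dvd order_dvdn gX1 prim_expr_order // eqxx /=.
by rewrite (prim_order_dvd prim_z) -gX1 expg_order.
Qed.

End UnitaryCenter.

(** * The first isomorphism theorem for a group embedded in a larger one *)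

(** [A] is seen through its embedding [v] into [B]: on [G], [psi] has kernel [N] and the same image
    as [v]. Since [A] and [B] may be infinite, the isomorphism is built by hand from lifts. *)
Lemma quotient_group_isomorphic (gT : finGroupType) (G N : {group gT})
    (A B : groupType) (v : A -> B) (psi : gT -> B) :
    (N <| G)%g -> injective v -> {morph v : x y / (x * y)%g} ->
    {in G &, {morph psi : x y / (x * y)%g}} ->
    {in G, forall g, psi g = 1%g <-> g \in N} ->
    {in G, forall g, exists a, v a = psi g} ->
    (forall a, exists2 g, g \in G & psi g = v a) ->
  group_isomorphic A [subg (G / N)%G].
Proof.
move=> nNG v_inj vM psiM kerpsi imv impsi.
have psi1 : psi 1%g = 1%g by apply/kerpsi; rewrite group1.
have coset_eqP g h : g \in G -> h \in G ->
    coset N g = coset N h <-> psi g = psi h.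
  move=> Gg Gh; have nG := subsetP (normal_norm nNG).
  have Ggh : (g * h^-1)%g \in G by rewrite groupM ?groupV.
  have psi_gh : psi g = (psi (g * h^-1) * psi h)%g by rewrite -psiM ?mulgKV.
  split=> [/(rcoset_kercosetP (nG _ Gg) (nG _ Gh))|gh].
    by rewrite mem_rcoset => /(kerpsi _ Ggh) gh1; rewrite psi_gh gh1 mul1g.
  apply/(rcoset_kercosetP (nG _ Gg) (nG _ Gh)); rewrite mem_rcoset.
  by apply/(kerpsi _ Ggh)/(mulIg (psi h)); rewrite -psi_gh mul1g.
(* A lift is determined up to [N], so by [coset_eqP] its coset depends only on [a]. *)
pose lift a := s2val (cid2 (impsi a)).
have liftG a : lift a \in G by rewrite /lift; case: cid2.
have liftE a : psi (lift a) = v a by rewrite /lift; case: cid2.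
pose f a : [subg (G / N)%G] := subg (G / N) (coset N (lift a)).
have fE a : sgval (f a) = coset N (lift a) by rewrite subgK ?mem_quotient.
have fM : {morph f : x y / (x * y)%g}.
  move=> a b; apply: val_inj; rewrite /= -/(sgval _) !fE.
  rewrite -coset_morphM ?(subsetP (normal_norm nNG)) //.
  by apply/coset_eqP; rewrite ?groupM // psiM // !liftE vM.
have ex_rep (y : [subg (G / N)%G]) : exists2 g, g \in G & coset N g = sgval y.
  by have /morphimP[g _ Gg ->] := subgP y; exists g.
have ex_inv y : exists a, f a = y.
  have [g Gg gy] := ex_rep y; have [a va] := imv g Gg; exists a.
  apply: val_inj; rewrite /= -/(sgval _) fE -gy.
  by apply/coset_eqP; rewrite ?liftE.
have f_inj : injective f.
  move=> a b /(congr1 sgval); rewrite !fE => /coset_eqP.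
  by rewrite !liftE => h; apply/v_inj/h.
pose f_mul := isMultiplicative.Build A [subg (G / N)%G] f fM.
pose fm : {multiplicative A -> [subg (G / N)%G]} := HB.pack f f_mul.
exists fm; exists (fun y => sval (cid (ex_inv y))) => [a|y]; last by case: cid.
by apply: f_inj; case: cid.
Qed.

(** * From unitary matrices to automorphisms of the hypersurface *)

Section UnitaryToAut.
Variables (k : closedFieldType) (p e m : nat) (chark : p \in [pchar k]).
Variables (L : finFieldType) (charL : p \in [pchar L]).
Hypotheses (e_gt0 : (0 < e)%N) (card_L : #|L| = ((p ^ e) ^ 2)%N).
Variables (iota : {rmorphism L -> k}).
Hypothesis iota_im : forall x, x ^+ #|L| = x -> exists y, iota y = x.
Local Notation n := m.+2.
Local Notation q := (p ^ e)%N.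
Local Notation frobT := (frob_trmx e chark).
Local Notation U := (unitary_group n e charL).
Variables (F : {mpoly k[n]}) (A B : 'M[k]_n).
Hypothesis evF : forall v, eval_at F v = (frobT v *m A *m v) 0 0.
Hypothesis uB : B \in unitmx.
Hypothesis orthoB : frobT B *m A *m B = 1%:M.

(** [B] carries Fermat coordinates to those of [F], so conjugation by it moves symmetries of the
    Fermat form to symmetries of [F]. *)
Definition unitary_conj (g : {'GL_n[L]}) : 'M[k]_n :=
  B *m map_mx iota (GLval g) *m invmx B.

Fact unitary_conj_unit g : unitary_conj g \in unitmx.
Proof.
rewrite !unitmx_mul uB unitmx_inv uB map_unitmx andbT /=.
by have := GL_unit g.
Qed.

Definition unitary_pgl g : pgl k n :=
  \pi_(pgl k n) (GLmx (unitary_conj_unit g)).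

Lemma unitary_pglM : {morph unitary_pgl : g h / (g * h)%g}.
Proof.
move=> g h; rewrite /unitary_pgl [RHS]pi_pglM; congr (\pi_(pgl k n) _).
apply: val_inj.
by rewrite /= /unitary_conj GL_MxE map_mxM !mulmxA mulmxKV.
Qed.

Lemma iota_frob l1 l2 (X : 'M[L]_(l1, l2)) :
  map_mx iota (map_mx (frob e charL) X) = map_mx (frob e chark) (map_mx iota X).
Proof. by apply/matrixP=> i j; rewrite !mxE rmorphXn. Qed.

Lemma form_in_orthonormal_basis l (w : 'M[k]_(n, l)) :
  frobT (B *m w) *m A *m (B *m w) = frobT w *m w.
Proof.
by rewrite frobTM !mulmxA -!(mulmxA (frobT w)) orthoB mul1mx.
Qed.

Lemma unitary_pgl_preserves g : g \in U ->
  preserves (zero_locus F) (unitary_pgl g).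
Proof.
rewrite inE => /eqP Ug; elim/quotW=> v.
rewrite pi_pgl_act !(zero_locus_form _ evF) /= /unitary_conj.
have fg : frobT (map_mx iota (GLval g)) *m map_mx iota (GLval g) = 1%:M.
  by rewrite /frob_trmx -iota_frob map_trmx -map_mxM Ug map_mx1.
have [w vE] : exists w, nz_vec v = B *m w.
  by exists (invmx B *m v); rewrite mulKVmx.
have -> : B *m map_mx iota (GLval g) *m invmx B *m v
    = B *m (map_mx iota (GLval g) *m w) by rewrite vE !mulmxA mulmxKV.
rewrite vE !form_in_orthonormal_basis frobTM !mulmxA.
by rewrite -(mulmxA _ (frobT _)) fg mulmx1.
Qed.

Lemma unitary_pgl_eq1 g : g \in U -> unitary_pgl g = 1%g <-> g \in 'Z(U)%g.
Proof.
move=> Ug; split=> [/eqP/pglP[c c0 gc]|Zg]; last first.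
  have [l gl] := unitary_center_scalar card_L Zg.
  have l0 : l != 0.
    apply/eqP=> l0; have := GL_unit g; rewrite gl l0 raddf0.
    by rewrite -[_ \is a _]/(_ \in unitmx) unitmxE det0 unitr0.
  apply/eqP/pglP; exists (iota l); first by rewrite fmorph_eq0.
  rewrite /= /unitary_conj gl map_scalar_mx mul_mx_scalar -scalemxAl.
  by rewrite mulmxV.
apply: (scalar_unitary_center (l := GLval g 0 0)) => //.
(* Undoing the conjugation leaves a scalar over k; being the image of the corner entry of g, it
   descends to [L]. *)
have ig : map_mx iota (GLval g) = c%:M.
  have := congr1 (fun M => invmx B *m (M *m B)) gc.
  rewrite /= /unitary_conj mulmxKV // mulKmx // -scalemxAl mul1mx -scalemxAr.
  by rewrite mulVmx // scalemx1.
apply/matrixP=> i j; apply: (fmorph_inj iota).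
have /matrixP igE := ig; have := igE i j; have := igE 0 0.
by rewrite !mxE eqxx mulr1n rmorphMn => -> ->.
Qed.

Lemma preserves_unitary_pgl a : preserves (zero_locus F) a ->
  exists2 g, g \in U & unitary_pgl g = a.
Proof.
elim/quotW: a => G presG; pose h := invmx B *m G *m B.
have uh : h \in unitmx by rewrite !unitmx_mul unitmx_inv uB gl_unit.
have Gh : (G : 'M_n) *m B = B *m h by rewrite /h -mulmxA mulKVmx.
have [c hc] : exists c, frobT h *m h = c%:M.
  apply: (form_vanishing_on_fermat (chark := chark) e_gt0) => // w w0.
  (* The zero vector is no projective point and is treated apart. *)
  have [->|wn0] := eqVneq w 0; first by rewrite mulmx0.
  have Bw0 : B *m w != 0.
    by apply: contra_neq wn0 => Bw; rewrite -[w](mulKmx uB) Bw mulmx0.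
  have := presG (\pi_(proj k n) (NzVec Bw0)).
  rewrite pi_pgl_act !(zero_locus_form _ evF) /= form_in_orthonormal_basis.
  rewrite [_ *m (B *m w)]mulmxA Gh -(mulmxA B) form_in_orthonormal_basis frobTM.
  rewrite !mulmxA.
  by case=> _; apply.
have c0 : c != 0.
  have : frobT h *m h \in unitmx by rewrite unitmx_mul frobT_unit uh.
  apply: contraTneq => c0; rewrite hc c0 raddf0.
  by rewrite unitmxE det0 unitr0.
have [l lc] := @closed_root_expn k c^-1 q.+1 isT.
have l0 : l != 0.
  by apply: contra_eq_neq lc => ->; rewrite expr0n eq_sym invr_eq0.
pose h' := l *: h.
have uh' : frobT h' *m h' = 1%:M.
  rewrite frobTZ -scalemxAl -scalemxAr scalerA hc -exprSr lc scale_scalar_mx.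
  by rewrite mulVf.
(* Conjugate transposition of [uh'] shows that [h'] and its q^2-Frobenius are both right inverses of
   [frobT h']. *)
have fixh' : map_mx (frob (e * 2) chark) h' = h'.
  have [uf _] := mulmx1_unit uh'.
  have := congr1 (fun M => frobT M) uh'.
  rewrite /= frobTM frobT1 frobTK -[in RHS]uh'.
  by move/(congr1 (mulmx (invmx (frobT h')))); rewrite !mulKmx.
have [H Hh'] : exists H : 'M[L]_n, map_mx iota H = h'.
  have ex_pre i j : exists y, iota y == h' i j.
    have [|y yE] := @iota_im (h' i j); last by exists y; apply/eqP.
    by rewrite card_L -expnM; have /matrixP/(_ i j) := fixh'; rewrite mxE.
  exists (\matrix_(i, j) xchoose (ex_pre i j)); apply/matrixP=> i j.
  by rewrite !mxE (eqP (xchooseP (ex_pre i j))).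
have uH : (map_mx (frob e charL) H)^T *m H = 1%:M.
  apply: (map_mx_inj (f := iota)).
  by rewrite map_mxM -map_trmx iota_frob Hh' map_mx1.
have [g Ug gH] := @unitary_mx n _ _ _ _ _ uH.
exists g => //; apply/eqP/pglP; exists l => //.
rewrite /= /unitary_conj gH Hh' -scalemxAr -scalemxAl; congr (_ *: _).
by rewrite -Gh mulmxK.
Qed.

Lemma proj_aut_isomorphic_PU :
  group_isomorphic (proj_aut (zero_locus F)) (PU n e charL).
Proof.
apply: (@quotient_group_isomorphic _ U 'Z(U)%G _ (pgl k n) val unitary_pgl).
- exact: center_normal.
- exact: val_inj.
- by [].
- by move=> g h _ _; apply: unitary_pglM.
- exact: unitary_pgl_eq1.
- move=> g /unitary_pgl_preserves/asboolP pg.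
  by exists (ProjAut pg).
move=> a; apply: preserves_unitary_pgl; apply/asboolP; exact: valP a.
Qed.

End UnitaryToAut.

Unset Implicit Arguments.

(** [L] stands for F_{q^2}. [PU] is defined as the quotient by the center, and the last three
    clauses identify that center with the cyclic group of norm-one scalars. *)
Theorem theorem3p3p1 (k : closedFieldType) (p e n : nat)
    (char_k : p \in [pchar k]) (e_ge1 : (1 <= e)%N) (n_ge2 : (2 <= n)%N)
    (F : {mpoly k[n]}) (F_frob : frobenius_form (p ^ e) F)
    (X_smooth : smooth_hypersurface F)
    (L : finFieldType) (char_L : p \in [pchar L])
    (card_L : #|L| = ((p ^ e) ^ 2)%N) :
  [/\ group_isomorphic (proj_aut (zero_locus F)) (PU n e char_L),
      'Z(unitary_group n e char_L)%g
        = [set g | [exists l : L,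
            (l ^+ (p ^ e).+1 == 1) && (GLval g == l%:M)]],
      cyclic 'Z(unitary_group n e char_L)%g
    & #|'Z(unitary_group n e char_L)%g| = (p ^ e).+1].
Proof.
have [cycZ cardZ] := unitary_center_cyclic n char_L card_L.
split=> //; last exact: unitary_centerE.
(* With n of the form [m.+2], the size [n.-1.+1] of matrices in ['GL_n[L]] is convertible to n. *)
case: n n_ge2 F F_frob X_smooth {cycZ cardZ} =>
  [|[|m]] // n_ge2 F F_frob X_smooth.
have [A [evF evdF]] := frobenius_form_mx char_k e_ge1 F_frob.
have uA := smooth_frobenius_form_unit evF evdF X_smooth.
have [B uB orthoB] := orthonormal_basis char_k e_ge1 uA.
have [iota iota_im] := finField_closed_embedding char_L char_k.
exact: (proj_aut_isomorphic_PU _ e_ge1 card_L iota_im evF uB orthoB).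
Qed.
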